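(* Let $(X,\mathcal{X})$ be a measurable space, let $\mathcal{F}$ be a separable, uniformly bounded family of measurable functions $f:X\to\mathbb{R}$, and let $\gamma>0$. Consider the conditions: (a) $\mathcal{F}$ has finite $\gamma$-dimension. (b) No sequence in $\mathcal{F}$ is Boolean independent at levels $(\alpha,\beta)$ with $\beta-\alpha\ge\gamma$. (c) $N_{[]}(\mathcal{F},\varepsilon,\mu)<\infty$ for every $\varepsilon>\gamma$ and every probability measure $\mu$ on $(X,\mathcal{X})$. Then the implications (a) $\Rightarrow$ (b) $\Rightarrow$ (c) hold.
   Context: A class $\mathcal{F}$ of functions on $X$ is separable if it contains a countable subset that is dense in $\mathcal{F}$ for the topology of pointwise convergence in $\mathbb{R}^X$. A family $\mathcal{F}$ of functions on $X$ $\gamma$-shatters a subset $X_0\subseteq X$ if there exist levels $\alpha<\beta$ with $\beta-\alpha\ge\gamma$ such that for every finite subset $\{x_1,\dots,x_n\}\subseteq X_0$ (distinct points) and every $F\subseteq\{1,\dots,n\}$ there exists $f\in\mathcal{F}$ with $f(x_j)<\alpha$ for $j\in F$ and $f(x_j)>\beta$ for $j\notin F$. The $\gamma$-dimension of $\mathcal{F}$ is the maximal cardinality of $\gamma$-shattered finite subsets of $X$ (infinite if there is no maximum). A sequence $(f_i)_{i\in\mathbb{N}}$ of functions on $X$ is Boolean independent at levels $(\alpha,\beta)$ if for every $n\in\mathbb{N}$ and every $F\subseteq\{1,\dots,n\}$ one has $\bigcap_{j\in F}\{f_j<\alpha\}\cap\bigcap_{j\in\{1,\dots,n\}\setminus F}\{f_j>\beta\}\ne\varnothing$.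 Given $\varepsilon>0$ and a probability measure $\mu$, a pair of measurable functions $f^-\le f^+$ (pointwise) with $\int(f^+-f^-)\,d\mu\le\varepsilon$ defines an $\varepsilon$-bracket in $L^1(\mu)$, $[f^-,f^+]:=\{f: f^-\le f\le f^+\text{ pointwise}\}$. $N_{[]}(\mathcal{F},\varepsilon,\mu)$ is the cardinality of the smallest collection of $\varepsilon$-brackets in $L^1(\mu)$ covering $\mathcal{F}$. *)

(* Defs.v *)
From HB Require Import structures.
From mathcomp Require Import all_boot all_order all_algebra.
From mathcomp Require Import all_classical all_reals all_analysis.
Import Order.TTheory GRing.Theory Num.Theory numFieldNormedType.Exports.

Set Implicit Arguments.
Unset Strict Implicit.
Unset Printing Implicit Defensive.

Local Open Scope classical_set_scope.
Local Open Scope ring_scope.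

Definition separable_class (R : realType) (X : Type) (F : set (X -> R)) : Prop :=
  exists D : set (X -> R), [/\ countable D, D `<=` F &
    F `<=` closure (D : set {ptws X -> R})].

Definition uniformly_bounded (R : realType) (X : Type) (F : set (X -> R)) : Prop :=
  exists M : R, forall f, F f -> forall x, `|f x| <= M.

Definition gamma_shatters (R : realType) (X : Type) (F : set (X -> R))
    (gamma : R) (X0 : set X) : Prop :=
  exists alpha beta : R, [/\ alpha < beta, gamma <= beta - alpha &
    forall (n : nat) (x : 'I_n -> X), injective x -> (forall j, X0 (x j)) ->
    forall S : {set 'I_n}, exists2 f : X -> R, F f &
      (forall j, j \in S -> f (x j) < alpha) /\
      (forall j, j \notin S -> beta < f (x j))].

(* The value is +oo exactly when there are shattered sets of arbitrarily large
   finite cardinality; it is -oo exactly when F is empty, since then not even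
   the empty set is shattered. *)
Definition gamma_dimension (R : realType) (X : Type) (F : set (X -> R))
    (gamma : R) : \bar R :=
  ereal_sup [set (n%:R)%:E | n in [set n : nat |
    exists A : set X, (A #= `I_n)%card /\ gamma_shatters F gamma A]].

Definition boolean_independent (R : realType) (X : Type) (f : nat -> X -> R)
    (alpha beta : R) : Prop :=
  forall (n : nat) (S : {set 'I_n}),
    (\bigcap_(j in [set j : 'I_n | j \in S]) [set x | f j x < alpha]) `&`
    (\bigcap_(j in [set j : 'I_n | j \notin S]) [set x | beta < f j x]) !=set0.

Definition is_bracket (d : measure_display) (X : measurableType d)
    (R : realType) (mu : probability X R) (eps : R) (b : (X -> R) * (X -> R)) : Prop :=
  [/\ measurable_fun setT b.1, measurable_fun setT b.2,
      (forall x, b.1 x <= b.2 x) &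
      (\int[mu]_x (b.2 x - b.1 x)%:E <= eps%:E)%E].

Definition bracket (R : realType) (X : Type) (b : (X -> R) * (X -> R)) : set (X -> R) :=
  [set f | forall x, b.1 x <= f x <= b.2 x].

(* The infimum of the empty set is +oo: the value is +oo exactly when F has no
   finite cover by eps-brackets. *)
Definition bracketing_number (d : measure_display) (X : measurableType d)
    (R : realType) (F : set (X -> R)) (eps : R) (mu : probability X R) : \bar R :=
  ereal_inf [set (n%:R)%:E | n in [set n : nat |
    exists b : 'I_n -> (X -> R) * (X -> R),
      (forall i, is_bracket mu eps (b i)) /\
      F `<=` \bigcup_(i in [set: 'I_n]) bracket (b i)]].

(* Main.v *)
(* (a) => (b) is the duality of shattering: 2^n members of a Boolean independent
   sequence, indexed by the subsets of {1..n}, shatter n points.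

   (b) => (c): let g enumerate a countable dense subset and suppose that it has
   no finite cover by eps-brackets. Then some ultrafilter U on nat contains no
   index set A for which g @` A has such a cover. For levels alpha < beta let
   W A be the set of points at which some member of g @` A is below alpha and
   some member above beta, and let B be the essential intersection of the
   W A, A in U. If B has positive measure, then for every C in B of positive
   measure, U-almost every g n cuts C below alpha and above beta in positive
   measure: otherwise the n failing to do so would form some A in U, and C would
   miss W A up to a null set. Cutting repeatedly produces a Boolean independent
   sequence. If B is null for all levels (alpha, alpha + gamma) of a fine finite
   grid, then some A in U has W A of small measure for all of them, and the
   bracket [inf_A g, sup_A g] has size at most eps, a contradiction. *)
Require Import Defs.
From mathcomp Require Import all_boot all_order all_algebra.
From mathcomp Require Import all_classical all_reals all_analysis.
From mathcomp Require Import lra measurable_realfun.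
Import Order.TTheory GRing.Theory Num.Theory numFieldNormedType.Exports.

Set Implicit Arguments.
Unset Strict Implicit.
Unset Printing Implicit Defensive.

Local Open Scope classical_set_scope.
Local Open Scope ring_scope.

(** * Essential intersection of a monotone family of sets along a filter *)

Lemma probability_bigcap_ge (R : realType) (d : measure_display)
    (X : measurableType d) (mu : probability X R) (E : nat -> set X) (e : R) :
  (forall n, measurable (E n)) ->
  {homo E : n m / (n <= m)%N >-> m `<=` n} ->
  (forall n, e%:E <= mu (E n))%E -> (e%:E <= mu (\bigcap_n E n))%E.
Proof.
move=> mE E_decr E_ge.
have cE : mu \o E @ \oo --> mu (\bigcap_n E n).
  apply: nonincreasing_cvg_mu => //.
  - by rewrite (le_lt_trans (probability_le1 _ (mE _)))// ltry.
  - exact: bigcapT_measurable.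
  - by move=> n m nm; apply/subsetPset; exact: E_decr.
by apply: cvge_ge cE; near=> n; exact: E_ge.
Unshelve. all: by end_near. Qed.

(** Choose [A n] in [U] with [mu (W (A n))] tending to the infimum [m] and intersect. The result has
    measure [m], and intersecting further with [W C] for [C] in [U] cannot lower this measure. *)
Lemma essential_bigcap (R : realType) (d : measure_display)
    (X : measurableType d) (mu : probability X R) (T : Type)
    (U : set_system T) (W : set T -> set X) :
  Filter U -> (forall A, measurable (W A)) -> {homo W : A B / A `<=` B} ->
  exists B, [/\ measurable B, forall A, U A -> mu (B `\` W A) = 0 &
    forall e : R, (forall A, U A -> e%:E <= mu (W A))%E -> (e%:E <= mu B)%E].
Proof.
move=> FU mW W_incr.
pose S := [set fine (mu (W A)) | A in U].
have S_fin A : (fine (mu (W A)))%:E = mu (W A).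
  by rewrite fineK// fin_num_measure.
have S_lb : has_lbound S by exists 0 => _ [A _ <-]; rewrite fine_ge0.
have S_inf : has_inf S.
  by split=> //; exists (fine (mu (W setT))), setT => //; exact: filterT.
pose m := inf S.
have m_le A : U A -> (m%:E <= mu (W A))%E.
  by move=> UA; rewrite -S_fin lee_fin; apply: ge_inf => //; exists A.
have /choice[A UA_lt] : forall n, exists B,
    U B /\ (mu (W B) < (m + n.+1%:R^-1)%:E)%E.
  move=> n; have n_gt0 : 0 < n.+1%:R^-1 :> R by rewrite invr_gt0.
  have [_ [B UB <-] B_lt] := inf_adherent n_gt0 S_inf.
  by exists B; split=> //; rewrite -S_fin lte_fin.
(* Finite intersections stay in [U] and make the sets decrease, as continuity from above
   requires. *)
pose A' n := [set t | forall i : 'I_n.+1, A i t].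
have UA' n : U (A' n) by apply: filter_forall => i; exact: (UA_lt i).1.
have A'_decr n k : (n <= k)%N -> A' k `<=` A' n.
  by move=> nk x Ax i; exact: (Ax (widen_ord (_ : n.+1 <= k.+1)%N i)).
have cap_ge C : U C -> (m%:E <= mu (\bigcap_n W (A' n `&` C)))%E.
  move=> UC; apply: probability_bigcap_ge => //.
  - by move=> n k nk; apply: W_incr; apply: setSI; exact: A'_decr.
  - by move=> n; apply: m_le; exact: filterI.
have mB : measurable (\bigcap_n W (A' n)) by exact: bigcapT_measurable.
have B_ge : (m%:E <= mu (\bigcap_n W (A' n)))%E.
  rewrite (_ : \bigcap_n _ = \bigcap_n W (A' n `&` setT)).
    by apply: cap_ge; exact: filterT.
  by apply: eq_bigcapr => n _; rewrite setIT.
exists (\bigcap_n W (A' n)); split=> //.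
- move=> C UC.
  have B_le : (mu (\bigcap_n W (A' n)) <= m%:E)%E.
    apply/lee_addgt0Pr => e e_gt0.
    have [n _ ne] : \forall n \near \oo, (n.+1%:R^-1 < e :> R).
      by apply: near_infty_natSinv_lt (PosNum e_gt0).
    have := ne n (leqnn n) => /= {}ne.
    apply: le_trans (_ : (mu (W (A n)) <= _)%E).
      apply: le_measure; rewrite ?inE//.
      by move=> x /(_ n I); apply: W_incr => t /(_ ord_max).
    by rewrite ltW// (lt_trans (UA_lt n).2)// lte_fin ltrD2l.
  rewrite measureD//; last first.
    by rewrite (le_lt_trans (probability_le1 _ mB))// ltry.
  apply/eqP; rewrite eq_le; apply/andP; split; last first.
    rewrite sube_ge0 ?fin_num_measure//; last exact: measurableI.
    by apply: le_measure; rewrite ?inE//; exact: measurableI.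
  rewrite leeBlDr ?fin_num_measure//; last exact: measurableI.
  rewrite add0e (le_trans B_le)// (le_trans (cap_ge C UC))//.
  apply: le_measure; rewrite ?inE//; first exact: bigcapT_measurable.
    exact: measurableI.
  move=> x Wx; split=> [n _|]; first by apply: W_incr (Wx n I).
  by apply: W_incr (Wx 0%N I).
- move=> e e_le; apply: le_trans B_ge; rewrite lee_fin.
  apply: lb_le_inf; first exact: S_inf.1.
  by move=> _ [C UC <-]; rewrite -lee_fin S_fin; exact: e_le.
Qed.

(** * Oscillation sets and Boolean independent sequences *)

(** The value [true] corresponds to membership in the set [S] of [boolean_independent]. *)
Definition side (R : realType) (X : Type) (alpha beta : R) (f : X -> R)
    (b : bool) : set X :=
  if b then [set x | f x < alpha] else [set x | beta < f x].

Definition oscillation (R : realType) (X : Type) (alpha beta : R)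
    (g : nat -> X -> R) (A : set nat) : set X :=
  \bigcap_(b in [set: bool]) \bigcup_(n in A) side alpha beta (g n) b.

Lemma measurable_side (R : realType) (d : measure_display)
    (X : measurableType d) (alpha beta : R) (f : X -> R) (b : bool) :
  measurable_fun setT f -> measurable (side alpha beta f b).
Proof.
move=> mf; rewrite -[side _ _ _ _]setTI; case: b => /=.
  by rewrite -preimage_itvNyo; apply: mf.
by rewrite -preimage_itvoy; apply: mf.
Qed.

Lemma measurable_oscillation (R : realType) (d : measure_display)
    (X : measurableType d) (alpha beta : R) (g : nat -> X -> R) (A : set nat) :
  (forall n, measurable_fun setT (g n)) ->
  measurable (oscillation alpha beta g A).
Proof.
move=> mg; apply: fin_bigcap_measurable => // b _.
by apply: bigcup_measurable => n _; exact: measurable_side.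
Qed.

Lemma oscillation_subset (R : realType) (X : Type) (alpha beta : R)
    (g : nat -> X -> R) :
  {homo oscillation alpha beta g : A B / A `<=` B}.
Proof. by move=> A B AB x Wx b _; have [n /AB] := Wx b I; exists n. Qed.

Lemma near_side_gt0 (R : realType) (d : measure_display)
    (X : measurableType d) (mu : probability X R) (alpha beta : R)
    (g : nat -> X -> R) (U : set_system nat) (B C : set X) (b : bool) :
  UltraFilter U -> (forall n, measurable_fun setT (g n)) ->
  measurable B ->
  (forall A, U A -> mu (B `\` oscillation alpha beta g A) = 0) ->
  measurable C -> C `<=` B -> (0 < mu C)%E ->
  \forall n \near U, (0 < mu (C `&` side alpha beta (g n) b))%E.
Proof.
move=> UU mg mB B_osc mC CB C_gt0.
pose P := [set n | (0 < mu (C `&` side alpha beta (g n) b))%E].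
have [//|UP] := in_ultra_setVsetC P UU.
have mW := measurable_oscillation alpha beta (~` P) mg.
suff C0 : mu C = 0 by rewrite C0 ltxx in C_gt0.
apply: measure_negligible => //.
(* Off the oscillation set, [C] is null by [B_osc]; on it, each point lies on side [b] of some [g n]
   with [n] outside [P], and these countably many pieces are null. *)
apply: (@negligibleS _ _ _ _ ((B `\` oscillation alpha beta g (~` P)) `|`
    \bigcup_n (if n \in ~` P then C `&` side alpha beta (g n) b else set0))).
  move=> x Cx; have [Wx|] := pselect (oscillation alpha beta g (~` P) x).
    have [n Pn fx] := Wx b I; right; exists n => //.
    by rewrite mem_set.
  by left; split=> //; exact: CB.
apply: negligibleU.
  by apply/negligibleP; [exact: measurableD|exact: B_osc].
apply: negligible_bigcup => n; case: ifPn => [/set_mem /= nPn|_]; last first.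
  exact: negligible_set0.
have mCn : measurable (C `&` side alpha beta (g n) b).
  by apply: measurableI => //; exact: measurable_side.
apply/negligibleP => //; apply/eqP; rewrite eq_le measure_ge0 andbT leNgt.
exact/negP.
Qed.

(** The head of [ks] is the index chosen last, so a new choice cuts every existing cell once
    more. *)
Fixpoint cell (R : realType) (X : Type) (alpha beta : R) (g : nat -> X -> R)
    (B : set X) (ks : seq nat) (bs : seq bool) : set X :=
  match ks, bs with
  | k :: ks', b :: bs' =>
      cell alpha beta g B ks' bs' `&` side alpha beta (g k) b
  | _, _ => B
  end.

Lemma cell_subset (R : realType) (X : Type) (alpha beta : R)
    (g : nat -> X -> R) (B : set X) (ks : seq nat) (bs : seq bool) :
  cell alpha beta g B ks bs `<=` B.
Proof. by elim: ks bs => [//|k ks IH] [|b bs] //= x [/IH]. Qed.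

Lemma measurable_cell (R : realType) (d : measure_display)
    (X : measurableType d) (alpha beta : R) (g : nat -> X -> R) (B : set X)
    (ks : seq nat) (bs : seq bool) :
  (forall n, measurable_fun setT (g n)) -> measurable B ->
  measurable (cell alpha beta g B ks bs).
Proof.
move=> mg mB; elim: ks bs => [//|k ks IH] [|b bs] //=.
by apply: measurableI => //; exact: measurable_side.
Qed.

Lemma ultrafilter_boolean_independent (R : realType) (d : measure_display)
    (X : measurableType d) (mu : probability X R) (alpha beta : R)
    (g : nat -> X -> R) (U : set_system nat) (B : set X) :
  UltraFilter U -> (forall n, measurable_fun setT (g n)) ->
  measurable B -> (0 < mu B)%E ->
  (forall A, U A -> mu (B `\` oscillation alpha beta g A) = 0) ->
  exists k : nat -> nat, boolean_independent (g \o k) alpha beta.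
Proof.
move=> UU mg mB B_gt0 B_osc.
pose good ks := forall bs : (size ks).-tuple bool,
  (0 < mu (cell alpha beta g B ks bs))%E.
have extend ks : exists k, good ks -> good (k :: ks).
  have [ks_good|] := pselect (good ks); last by exists 0%N.
  (* There are finitely many pairs of a cell and a side, so a single [k] cuts all cells on both
     sides. *)
  have : \forall k \near U, forall bsb : (size ks).-tuple bool * bool,
      (0 < mu (cell alpha beta g B ks bsb.1
               `&` side alpha beta (g k) bsb.2))%E.
    apply: filter_forall => -[bs b] /=.
    apply: (near_side_gt0 (B := B)) => //.
    - exact: measurable_cell.
    - exact: cell_subset.
  move=> /(@filter_ex _ U)[k k_good]; exists k => _ bs.
  case/tupleP: bs => b bs /=; exact: (k_good (bs, b)).
have [next nextP] := boolp.choice extend.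
pose s := fix s n := if n is n'.+1 then next (s n') :: s n' else [::].
have size_s n : size (s n) = n by elim: n => //= n ->.
have s_good n : good (s n).
  elim: n => [|n /nextP//] bs /=; by case: (tval bs).
exists (next \o s) => n S.
(* [p] extends membership in [S] by [false] beyond [n]; [bits] lists its values in decreasing order
   of index, matching [s]. *)
pose p j := if insub j is Some i then i \in S else false.
pose bits := fix bits n := if n is n'.+1 then p n' :: bits n' else [::].
have size_bits m : size (bits m) == size (s m).
  by rewrite size_s; elim: m => //= m /eqP->.
have cell_side m x : cell alpha beta g B (s m) (bits m) x ->
    forall j, (j < m)%N -> side alpha beta (g (next (s j))) (p j) x.
  elim: m => [//|m IH] /= [cx sx] j; rewrite ltnS leq_eqVlt => /orP[/eqP->//|].
  exact: IH.
have [x cx] : cell alpha beta g B (s n) (bits n) !=set0.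
  have := s_good n (Tuple (size_bits n)).
  move=> cell_gt0; apply/set0P; apply: contraTN cell_gt0 => /eqP /= ->.
  by rewrite measure0 ltxx.
have sideS (j : 'I_n) : side alpha beta (g (next (s j))) (j \in S) x.
  by have := cell_side n x cx j (ltn_ord j); rewrite /p valK.
exists x; split=> j /= jS; have := sideS j.
  by rewrite jS.
by rewrite (negbTE jS).
Qed.

(** * Families with a finite cover by brackets *)

Definition finitely_bracketed (R : realType) (d : measure_display)
    (X : measurableType d) (mu : probability X R) (eps : R)
    (S : set (X -> R)) : Prop :=
  exists n (b : 'I_n -> (X -> R) * (X -> R)),
    (forall i, is_bracket mu eps (b i)) /\
    S `<=` \bigcup_(i in [set: 'I_n]) bracket (b i).

Lemma finitely_bracketedS (R : realType) (d : measure_display)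
    (X : measurableType d) (mu : probability X R) (eps : R)
    (S S' : set (X -> R)) :
  S `<=` S' -> finitely_bracketed mu eps S' -> finitely_bracketed mu eps S.
Proof.
move=> SS' [n [b [b_br S'b]]]; exists n, b; split=> //.
exact: subset_trans S'b.
Qed.

Lemma finitely_bracketed0 (R : realType) (d : measure_display)
    (X : measurableType d) (mu : probability X R) (eps : R) :
  finitely_bracketed mu eps set0.
Proof. by exists 0%N, (fun=> (cst 0, cst 0)); split=> // -[]. Qed.

Lemma finitely_bracketed1 (R : realType) (d : measure_display)
    (X : measurableType d) (mu : probability X R) (eps : R)
    (b : (X -> R) * (X -> R)) :
  is_bracket mu eps b -> finitely_bracketed mu eps (bracket b).
Proof. by move=> b_br; exists 1%N, (fun=> b); split=> // f; exists ord0. Qed.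

Lemma finitely_bracketedU (R : realType) (d : measure_display)
    (X : measurableType d) (mu : probability X R) (eps : R)
    (S S' : set (X -> R)) :
  finitely_bracketed mu eps S -> finitely_bracketed mu eps S' ->
  finitely_bracketed mu eps (S `|` S').
Proof.
move=> [n [b [b_br Sb]]] [n' [b' [b'_br S'b']]].
exists (n + n')%N,
  (fun i => match fintype.split i with inl j => b j | inr j => b' j end).
split=> [i|f [/Sb[i _ fi]|/S'b'[i _ fi]]].
- by case: fintype.split.
- by exists (lshift n' i) => //; rewrite (unsplitK (inl i)).
- by exists (rshift n i) => //; rewrite (unsplitK (inr i)).
Qed.

Lemma closed_bracket (R : realType) (X : eqType) (b : (X -> R) * (X -> R)) :
  closed (bracket b : set {ptws X -> R}).
Proof.
rewrite (_ : bracket b = \bigcap_(x in [set: X])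
    ((fun f : {ptws X -> R} => f x) @^-1` [set y | b.1 x <= y <= b.2 x])).
  apply: closed_bigI => x _; apply: preimage_closed.
    by move=> f _; exact: (@proj_continuous X (fun=> R) x).
  rewrite (_ : [set y | _] = `[b.1 x, b.2 x]%classic); last first.
    by apply/seteqP; split=> y /=; rewrite in_itv.
  exact: itv_closed.
by apply/seteqP; split=> f /= fb x; [move=> _; exact: fb|exact: (fb x I)].
Qed.

(** A finite union of brackets is closed for pointwise convergence, so a cover of a dense subset
    covers the whole family. *)
Lemma finitely_bracketed_closure (R : realType) (d : measure_display)
    (X : measurableType d) (mu : probability X R) (eps : R)
    (S : set (X -> R)) :
  finitely_bracketed mu eps S ->
  finitely_bracketed mu eps (closure (S : set {ptws X -> R})).
Proof.
move=> [n [b [b_br Sb]]]; exists n, b; split=> //.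
have /closure_id-> : closed
    (\bigcup_(i in [set: 'I_n]) bracket (b i) : set {ptws X -> R}).
  apply: closed_bigcup => [|i _]; first exact: finite_finset.
  exact: closed_bracket.
exact: (@closureS {ptws X -> R} _ _ Sb).
Qed.

(** The bracket consists of the pointwise infimum and supremum, measurable since the family is a
    sequence. Its width is at most [r] off [V] and at most [2 * M] on [V]. *)
Lemma bracket_of_oscillation (R : realType) (d : measure_display)
    (X : measurableType d) (mu : probability X R) (h : nat -> X -> R)
    (V : set X) (M r eps : R) :
  (forall n, measurable_fun setT (h n)) -> measurable V ->
  (forall n x, `|h n x| <= M) -> 0 <= r -> 0 <= M ->
  (forall x, ~ V x -> forall n m, h m x - h n x <= r) ->
  (r%:E + (2 * M)%:E * mu V <= eps%:E)%E ->
  exists b, is_bracket mu eps b /\ forall n, bracket b (h n).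
Proof.
move=> mh mV hM r_ge0 M_ge0 h_r eps_ge.
have h_ub x : has_ubound (range (h ^~ x)).
  by exists M => _ [n _ <-]; exact: le_trans (ler_norm _) (hM _ _).
have h_lb x : has_lbound (range (h ^~ x)).
  by exists (- M) => _ [n _ <-]; have := hM n x; rewrite ler_norml => /andP[].
pose l x := infs (h ^~ x) 0%N; pose u x := sups (h ^~ x) 0%N.
have lh n x : l x <= h n x.
  by apply: ge_inf; [exact: has_lbound_sdrop|exists n].
have hu n x : h n x <= u x.
  by apply: ub_le_sup; [exact: has_ubound_sdrop|exists n].
have ul_le x c : (forall n m, h m x - h n x <= c) -> u x - l x <= c.
  move=> h_c; rewrite lerBlDr; apply: ge_sup; first by exists (h 0%N x), 0%N.
  move=> _ [m _ <-]; rewrite -lerBlDl; apply: lb_le_inf.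
    by exists (h 0%N x), 0%N.
  by move=> _ [n _ <-]; rewrite lerBlDl -lerBlDr.
have mu_u : measurable_fun setT u by exact: measurable_fun_sups.
have mu_l : measurable_fun setT l by exact: measurable_fun_infs.
have lu x : l x <= u x by exact: le_trans (lh 0%N x) (hu 0%N x).
exists (l, u); split; last by move=> n x /=; rewrite lh hu.
split=> //=; apply: le_trans eps_ge.
have -> : (r%:E + (2 * M)%:E * mu V =
    \int[mu]_x (r%:E + (2 * M)%:E * (\1_V x)%:E))%E.
  rewrite ge0_integralD//; last 2 first.
  - by move=> x _; rewrite mule_ge0// lee_fin ?mulr_ge0.
  - by apply/measurable_EFinP/measurable_funM.
  rewrite integral_cst//= probability_setT mule1; congr (_ + _)%E.
  rewrite ge0_integralZl_EFin//; last by rewrite mulr_ge0.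
    by rewrite integral_indic// setIT.
  by apply/measurable_EFinP.
apply: ge0_le_integral => //.
- by move=> x _; rewrite lee_fin subr_ge0.
- by apply/measurable_EFinP/measurable_funB.
- by apply/measurable_EFinP/measurable_funD => //; apply/measurable_funM.
move=> x _; rewrite -EFinM -EFinD lee_fin indicE.
case: (boolP (x \in V)) => [_|/negP xV] /=.
  apply: ul_le => n m; have := hM n x; have := hM m x.
  by rewrite !ler_norml => /andP[? ?] /andP[? ?]; lra.
rewrite mulr0 addr0; apply: ul_le; apply: h_r => Vx; apply: xV.
exact: mem_set.
Qed.

(* The finitely bracketed families form an ideal, so the index sets with
   finitely bracketed complement form a proper filter. *)
Lemma not_bracketed_ultrafilter (R : realType) (d : measure_display)
    (X : measurableType d) (mu : probability X R) (eps : R)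
    (g : nat -> X -> R) :
  ~ finitely_bracketed mu eps (range g) ->
  exists2 U : set_system nat, UltraFilter U &
    forall A, U A -> ~ finitely_bracketed mu eps (g @` A).
Proof.
move=> g_nbr.
pose F0 : set_system nat := [set A | finitely_bracketed mu eps (g @` (~` A))].
have F0_filter : ProperFilter F0.
  apply: Build_ProperFilter; first by rewrite /F0 /= setC0.
  split.
  - by rewrite /F0 /= setCT image_set0; exact: finitely_bracketed0.
  - move=> A B FA FB; rewrite /F0 /= setCI image_setU.
    exact: finitely_bracketedU.
  - move=> A B AB; apply: finitely_bracketedS.
    by apply: image_subset; exact: subsetC.
have [U [UU F0U]] := ultraFilterLemma F0_filter.
exists U => // A UA A_br.
have : U (~` A) by apply: F0U; rewrite /F0 /= setCK.
move=> /(filterI UA); rewrite setICr; exact: filter_not_empty.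
Qed.

(** * Bracketing a bounded sequence by a finite grid of levels *)

Lemma grid_point (R : realType) (M delta v : R) :
  0 < delta -> `|v| <= M -> exists k : 'I_(Num.truncn (2 * M / delta)).+2,
    v < k%:R * delta - M <= v + delta.
Proof.
move=> delta_gt0; rewrite ler_norml => /andP[vM Mv].
have q_ge0 : 0 <= (v + M) / delta by apply: divr_ge0; lra.
have k_lt :
    ((Num.truncn ((v + M) / delta)).+1 < (Num.truncn (2 * M / delta)).+2)%N.
  rewrite !ltnS; apply: le_truncn; rewrite ler_pM2r ?invr_gt0//; lra.
(* This is the first grid point strictly above [v]. *)
exists (Ordinal k_lt) => /=.
have /andP[lo hi] := truncn_itv q_ge0.
move: lo hi; rewrite ler_pdivlMr// ltr_pdivrMr// -natr1 => lo hi.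
by apply/andP; split; lra.
Qed.

Lemma finitely_bracketed_range (R : realType) (d : measure_display)
    (X : measurableType d) (mu : probability X R) (gamma eps M : R)
    (g : nat -> X -> R) :
  (forall n, measurable_fun setT (g n)) -> (forall n x, `|g n x| <= M) ->
  0 < gamma -> gamma < eps ->
  (forall (k : nat -> nat) (alpha beta : R), gamma <= beta - alpha ->
    ~ boolean_independent (g \o k) alpha beta) ->
  finitely_bracketed mu eps (range g).
Proof.
move=> mg gM gamma_gt0 gamma_lt no_indep.
apply: contrapT => /not_bracketed_ultrafilter[U UU U_nbr].
have M_ge0 : 0 <= M := le_trans (normr_ge0 _) (gM 0%N point).
(* Half of the excess pays for the mesh of the grid, the other half for the exceptional set [V]. *)
pose delta := (eps - gamma) / 2.
have delta_gt0 : 0 < delta by rewrite /delta; lra.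
pose K := (Num.truncn (2 * M / delta)).+2.
pose alpha (k : nat) := k%:R * delta - M.
pose W k A := oscillation (alpha k) (alpha k + gamma) g A.
have mW k A : measurable (W k A) by exact: measurable_oscillation.
have W_incr k : {homo W k : A A' / A `<=` A'} by exact: oscillation_subset.
have W_small (e : R) k : 0 < e -> exists A, U A /\ (mu (W k A) < e%:E)%E.
  move=> e_gt0.
  have [B [mB B_osc B_ge]] := 
    essential_bigcap mu (@ultra_proper _ _ UU) (mW k) (@W_incr k).
  have [B_gt0|] := boolP (0 < mu B)%E.
    have [s] := 
      ultrafilter_boolean_independent UU mg mB B_gt0 B_osc.
    by move=> /no_indep; case; rewrite addrAC subrr add0r.
  rewrite -leNgt => B_le; apply: contrapT => no_A.
  suff : (e%:E <= mu B)%E by rewrite leNgt (le_lt_trans B_le)// lte_fin.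
  by apply: B_ge => A UA; rewrite leNgt; apply/negP => ?; apply: no_A; exists A.
(* [K] sets of measure at most [e] contribute at most [delta] to the integral, even with the factor
   [2 * M]; the [+ 1] avoids dividing by zero. *)
pose e := delta / (2 * M + 1) / K%:R.
have e_gt0 : 0 < e by rewrite !divr_gt0//; lra.
have /boolp.choice[A0 UA0] := fun k => W_small e k e_gt0.
pose A := [set n | forall k : 'I_K, A0 k n].
have UA : U A by apply: filter_forall => k; exact: (UA0 k).1.
have [a Aa] := filter_ex UA.
pose V := \big[setU/set0]_(k < K) W k A.
have mV : measurable V by exact: bigsetU_measurable.
have muV : (mu V <= (delta / (2 * M + 1))%:E)%E.
  apply: le_trans (Boole_inequality mu (fun k _ => mW k A)) _.
  apply: (@le_trans _ _ (\sum_(k < K) e%:E)%E).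
    apply: lee_sum => k _; apply: le_trans (ltW (UA0 k).2).
    by apply: le_measure; rewrite ?inE//; apply: W_incr => n /(_ k).
  by rewrite sumEFin sumr_const card_ord -[e *+ _]mulr_natr /e divfK ?pnatr_eq0.
pose h n := if n \in A then g n else g a.
have h_g n : exists2 n', A n' & h n = g n'.
  by rewrite /h; case: ifPn => [/set_mem An|_]; [exists n|exists a].
apply: (U_nbr A UA).
have [b [b_br hb]] : exists b, is_bracket mu eps b /\ forall n, bracket b (h n).
  apply: (@bracket_of_oscillation _ _ _ mu h V M (gamma + delta)) => //.
  - by move=> n; have [n' _ ->] := h_g n.
  - by move=> n x; have [n' _ ->] := h_g n.
  - by rewrite addr_ge0 ?ltW.
  - move=> x Vx n m; have [n' An ->] := h_g n; have [m' Am ->] := h_g m.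
    rewrite leNgt; apply/negP => osc; apply: Vx.
    (* The level just above [g n' x] exceeds it by at most [delta], so adding [gamma] stays below
       [g m' x] and [x] falls into [W k A]. *)
    have [k /andP[k_gt k_le]] := grid_point delta_gt0 (gM n' x).
    rewrite /V -(@bigcup_mkord _ K (fun k => W k A)).
    exists k => //= -[] _; first by exists n'.
    by exists m' => //=; rewrite /alpha; lra.
  apply: (@le_trans _ _
    ((gamma + delta)%:E + (2 * M)%:E * (delta / (2 * M + 1))%:E)%E).
    by rewrite leeD2l// lee_wpmul2l// lee_fin mulr_ge0.
  rewrite -EFinM -EFinD lee_fin.
  have D_gt0 : 0 < 2 * M + 1 by lra.
  have : 2 * M * (delta / (2 * M + 1)) <= delta.
    rewrite mulrA ler_pdivrMr// mulrC ler_wpM2l ?ltW//; lra.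
  by rewrite /delta; lra.
apply: finitely_bracketedS (finitely_bracketed1 b_br) => _ [n An <-].
by have := hb n; rewrite /h mem_set.
Qed.

(** * Duality between independence and shattering *)

Lemma boolean_independent_shatters (R : realType) (X : Type)
    (F : set (X -> R)) (gamma alpha beta : R) (f : nat -> X -> R) (n : nat) :
  alpha < beta -> gamma <= beta - alpha -> (forall i, F (f i)) ->
  boolean_independent f alpha beta ->
  exists A : set X, (A #= `I_n)%card /\ gamma_shatters F gamma A.
Proof.
move=> ab gab Ff f_indep.
have [x xP] : exists x : 'I_n -> X, forall j (S : {set 'I_n}),
    (j \in S -> f (enum_rank S) (x j) < alpha) /\
    (j \notin S -> beta < f (enum_rank S) (x j)).
  suff /boolp.choice[x xP] : forall j : 'I_n, exists x, forall S : {set 'I_n},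
    (j \in S -> f (enum_rank S) x < alpha) /\
    (j \notin S -> beta < f (enum_rank S) x) by exists x.
  move=> j.
  (* The point for [j] comes from independence of the first [2 ^ n] functions, with the subsets
     containing [j] on the low side. *)
  have [x [x_lt x_gt]] := 
    f_indep #|{set 'I_n}| [set i | j \in (enum_val i : {set 'I_n})]%SET.
  exists x => S; split=> jS.
    by apply: (x_lt (enum_rank S)) => /=; rewrite inE enum_rankK.
  by apply: (x_gt (enum_rank S)) => /=; rewrite inE enum_rankK.
have x_inj : injective x.
  move=> i j xij; apply/eqP; apply: contraT => ij.
  (* The function of the singleton of [i] separates [x i] from [x j]. *)
  have := (xP i [set i]%SET).1 (set11 i); rewrite xij.
  have := (xP j [set i]%SET).2; rewrite inE eq_sym => /(_ ij) gtb lta.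
  by have := lt_trans (lt_trans gtb lta) ab; rewrite ltxx.
exists (range x); split.
  by rewrite (card_eqr card_II); apply: inj_card_eq => i j _ _ /x_inj.
exists alpha, beta; split=> // m y y_inj yx S.
have /boolp.choice[p pP] : forall k, exists j, x j = y k.
  by move=> k; have [j _ <-] := yx k; exists j.
have p_inj : injective p by move=> k l pkl; apply: y_inj; rewrite -!pP pkl.
(* [S] is transported to indices of [x]; injectivity of [p] keeps its complement outside the
   image. *)
exists (f (enum_rank (p @: S))) => //; split=> k kS; rewrite -pP.
  by apply: (xP _ _).1; rewrite imset_f.
by apply: (xP _ _).2; rewrite mem_imset.
Qed.

(** * The two implications *)

Theorem theorem1p6 (R : realType) (d : measure_display) (X : measurableType d)
    (F : set (X -> R)) (gamma : R)
    (F_separable : separable_class F)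
    (F_bounded : uniformly_bounded F)
    (F_measurable : forall f, F f -> measurable_fun setT f)
    (gamma_gt0 : 0 < gamma) :
  let cond_a := (gamma_dimension F gamma < +oo)%E in
  let cond_b :=
    ~ exists f : nat -> X -> R, (forall i, F (f i)) /\
        exists alpha beta : R,
          gamma <= beta - alpha /\ boolean_independent f alpha beta in
  let cond_c := forall eps : R, gamma < eps -> forall mu : probability X R,
    (bracketing_number F eps mu < +oo)%E in
  (cond_a -> cond_b) /\ (cond_b -> cond_c).
Proof.
split.
  move=> dim_lt [f [Ff [alpha [beta [gab f_indep]]]]].
  have ab : alpha < beta by lra.
  suff dimE : gamma_dimension F gamma = +oo%E.
    by move: dim_lt; rewrite /= dimE ltxx.
  apply/eqyP => r r_gt0.
  apply: (@le_trans _ _ ((Num.truncn r).+1%:R)%:E).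
    by rewrite lee_fin ltW// truncnS_gt.
  apply: ereal_sup_ubound; exists (Num.truncn r).+1 => //.
  exact: boolean_independent_shatters f_indep.
move=> cond_b eps gamma_lt mu.
suff [n [b [b_br Fb]]] : finitely_bracketed mu eps F.
  apply: le_lt_trans (ltry (n%:R : R)); apply: ereal_inf_lbound.
  by exists n => //; exists b.
have [D [D_count DF FD]] := F_separable.
apply: (finitely_bracketedS FD); apply: finitely_bracketed_closure.
(* Only a nonempty countable set is the range of a sequence. *)
have [->|/set0P D_neq0] := eqVneq D set0; first exact: finitely_bracketed0.
have [M FM] := F_bounded.
have [f0 Df0] := D_neq0.
move: D_count => /pfcard_geP[D0|[g]]; first by rewrite D0 in Df0.
have Dg n : D (g n) by apply: funS.
apply: (@finitely_bracketedS _ _ _ mu eps _ (range g)).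
  by move=> f Df; have [n _ <-] := @surj _ _ setT D g f Df; exists n.
apply: (@finitely_bracketed_range _ _ _ mu gamma eps M) => //.
- by move=> n; apply: F_measurable; exact: DF.
- by move=> n x; apply: FM; exact: DF.
move=> k alpha beta gab g_indep; apply: cond_b.
exists (g \o k); split; first by move=> i; exact: (DF _ (Dg (k i))).
by exists alpha, beta.
Qed.
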